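(* Let $G$ be a finite simple graph. If $G$ is $4$-colorable (that is, $G$ has a proper vertex coloring using at most $4$ colors), then $G$ admits a sequential embedding in $\mathbb{R}^2$.
   Context: Let $d$ be a positive integer. A sequential embedding of a graph $G$ in $\mathbb{R}^d$ is a (not necessarily planar, i.e. edges are allowed to cross) drawing of $G$ in $\mathbb{R}^d$ in which the vertices of $G$ are placed at distinct points of $\mathbb{R}^d$ and each edge is drawn as the straight line segment between its endpoints, such that (i) the vertices of $G$ lie in $\mathbb{Z}^d$, and (ii) for any two adjacent vertices, the line segment between them contains no interior integer points (no point of $\mathbb{Z}^d$ other than its two endpoints). *)

(* Defs.v *)
From mathcomp Require Import all_boot all_order all_algebra.
From mathcomp Require Import reals.

Set Implicit Arguments.
Unset Strict Implicit.
Unset Printing Implicit Defensive.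

Import Order.TTheory GRing.Theory Num.Theory.
Local Open Scope ring_scope.

Definition simple_graph (V : finType) (e : rel V) : Prop :=
  symmetric e /\ irreflexive e.

Definition colorable (V : finType) (e : rel V) (k : nat) : Prop :=
  exists c : V -> 'I_k, forall x y : V, e x y -> c x != c y.

Section SequentialEmbedding.

Variables (R : realType) (d : nat).

Definition integer_point (p : 'rV[R]_d) : Prop :=
  forall i : 'I_d, p 0 i \is a Num.int.

Definition on_segment (u v p : 'rV[R]_d) : Prop :=
  exists t : R, 0 <= t <= 1 /\ p = (1 - t) *: u + t *: v.

(* A straight-line drawing is determined by the positions of the vertices. *)
Definition sequential_embedding (V : finType) (e : rel V)
    (f : V -> 'rV[R]_d) : Prop :=
  [/\ injective f,
      forall x : V, integer_point (f x) &
      forall x y : V, e x y -> forall p : 'rV[R]_d,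
        on_segment (f x) (f y) p -> integer_point p -> p = f x \/ p = f y].

End SequentialEmbedding.

(* Main.v *)
Require Import Defs.
From mathcomp Require Import all_boot all_order all_algebra.
From mathcomp Require Import reals.
From mathcomp Require Import zify ring.

(** Two lattice points see each other as soon as no prime divides both
    coordinate differences.  Put the i-th of n vertices, of colour 2b + a with
    a, b in {0, 1}, at (a + (n+1)! i, y), where y = b modulo every prime
    p <= n + 1 and y = i modulo every larger prime up to a bound exceeding all
    horizontal differences, which are nonzero.  A prime p <= n + 1 sees only
    the colours, which are distinct corners of the unit square and hence
    distinct modulo p; for a larger prime dividing the horizontal difference,
    the vertical difference is i - j modulo p, nonzero since |i - j| < p. *)

Set Implicit Arguments.
Unset Strict Implicit.
Unset Printing Implicit Defensive.

Import Order.TTheory GRing.Theory Num.Theory.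

Lemma eqmod_dvd (p d m n : nat) :
  p %| d -> m = n %[mod d] -> m = n %[mod p].
Proof. by move=> pd mn; rewrite -(modn_dvdm m pd) mn modn_dvdm. Qed.

Lemma prime_dvdn_part (pi : nat_pred) (p n : nat) :
  prime p -> p \in pi -> 0 < n -> p %| n -> p %| n`_pi.
Proof.
move=> pp ppi n0 pn.
by rewrite -(part_pnat_id (pi := pi) (n := p)) ?pnatE // partn_dvd.
Qed.

Lemma coprimez_sub_nat (a b c d : nat) :
  (forall p, prime p -> a = b %[mod p] -> c = d %[mod p] -> False) ->
  coprimez (a%:Z - b%:Z) (c%:Z - d%:Z).
Proof.
have modE (p m k : nat) : (p%:Z %| (m%:Z - k%:Z)%R)%Z -> m = k %[mod p].
  by rewrite -eqz_mod_dvd !modz_nat => /eqP[].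
move=> H; rewrite coprimezE /coprime; apply/negPn/negP => g1.
have [] := @pdivP (gcdn `|(a%:Z - b%:Z)%R| `|(c%:Z - d%:Z)%R|).
  rewrite ltn_neqAle eq_sym g1 /= gcdn_gt0 !absz_gt0.
  (* A zero gcd means that both differences vanish; then any prime, here 2, contradicts [H]. *)
  apply/negPn/negP; rewrite negb_or !negbK !subr_eq0.
  by move=> /andP[/eqP[ab] /eqP[cd]]; apply: (H 2); rewrite ?ab ?cd.
by move=> p pp; rewrite dvdn_gcd => /andP[/modE pa /modE pc]; apply: (H p).
Qed.

Lemma colored_placement (n : nat) (c : 'I_n -> 'I_4) :
  exists x y : 'I_n -> nat, injective x /\
    forall i j, c i != c j -> forall p, prime p ->
      x i = x j %[mod p] -> y i = y j %[mod p] -> False.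
Proof.
(* [B] bounds every [x i], its summand [n.+1] leaving room for the colour bit. The primes dividing
   [K] are those up to [B]; its [pi] and [pi^'] parts serve as coprime moduli for [y]. *)
pose F := (n.+1)`!; pose B := F * n + n.+1; pose K := B`!.
pose pi : nat_pred := [pred p | p <= n.+1].
pose x (i : 'I_n) := F * i + c i %% 2.
pose y (i : 'I_n) := chinese K`_pi K`_pi^' (c i %/ 2) i.
have c2 i : c i %% 2 < 2 by rewrite ltn_mod.
have xinj : injective x.
  move=> i j ij; apply/val_inj => /=.
  (* With [F = 1] a colour bit could offset a change of index; this happens only for [n = 0],
     excluded by the presence of [i]. *)
  have F1 : 1 < F.
    have n0 : 0 < n := leq_ltn_trans (leq0n i) (ltn_ord i).
    by rewrite dvdn_leq ?fact_gt0 // dvdn_fact.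
  by have := c2 i; have := c2 j; move: ij; rewrite /x; nia.
exists x, y; split=> // i j cij p pp xij yij.
have p1 := prime_gt1 pp.
have K0 : 0 < K by rewrite fact_gt0.
have coK := coprime_partC pi K K.
(* In each range of [p] the congruences force equal colours, for primes above [n.+1] by forcing
   [i = j]. *)
case: (negP cij); apply/eqP.
have [pn|np] := leqP p n.+1.
  have pF : p %| F by rewrite dvdn_fact // prime_gt0.
  have pK : p %| K`_pi.
    by apply: prime_dvdn_part => //; rewrite dvdn_fact // prime_gt0 //=; lia.
  have xE k : x k = c k %% 2 %[mod p].
    by rewrite /x -modnDml -modnMml (eqP pF) mul0n mod0n.
  have yE k : y k = c k %/ 2 %[mod p].
    by apply: eqmod_dvd pK _; rewrite chinese_modl.
  have small k : c k %/ 2 < p by apply: leq_trans p1; rewrite ltn_divLR.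
  apply/val_inj; rewrite /= (divn_eq (c i) 2) (divn_eq (c j) 2).
  move: xij yij; rewrite !xE !yE !(modn_small (small _)) => + ->.
  by rewrite !(modn_small (leq_trans (c2 _) p1)) => ->.
have [pB|Bp] := leqP p B.
  have pK : p %| K`_pi^'.
    apply: prime_dvdn_part => //; first by rewrite !inE -ltnNge.
    by rewrite dvdn_fact // prime_gt0.
  have yE k : y k = k %[mod p] by apply: eqmod_dvd pK _; rewrite chinese_modr.
  move: yij; rewrite !yE => /eqP; rewrite !modn_small => [/eqP/val_inj->//| |];
    exact: ltn_trans (leqW (ltn_ord _)) np.
have xB k : x k < p.
  apply: leq_ltn_trans Bp; apply: leq_add; first by rewrite leq_mul // ltnW.
  by apply: leq_trans (_ : 1 <= n.+1); first by rewrite -ltnS.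
by move: xij; rewrite !modn_small // => /xinj ->.
Qed.

Local Open Scope ring_scope.

(** If the point has coordinates [m] and [k], then [t * (a - b) = a - m] and [t * (c - d) = c - k];
    a Bezout combination of the two shows that [t] itself is an integer. *)
Lemma coprime_segment_int (R : realType) (a b c d : int) (t : R) :
  coprimez (a - b) (c - d) -> 0 <= t <= 1 ->
  (1 - t) * a%:~R + t * b%:~R \is a Num.int ->
  (1 - t) * c%:~R + t * d%:~R \is a Num.int ->
  t = 0 \/ t = 1.
Proof.
move=> /coprimezP[[u v] /= uv] t01.
move=> /Num.Theory.intrP[m tm] /Num.Theory.intrP[k tk].
have uvR : u%:~R * (a%:~R - b%:~R) + v%:~R * (c%:~R - d%:~R) = 1 :> R.
  by rewrite -!intrB -!intrM -intrD uv.
have tE : t = (u * (a - m) + v * (c - k))%:~R.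
  rewrite intrD !intrM !intrB -tm -tk.
  by transitivity (t * (u%:~R * (a%:~R - b%:~R) + v%:~R * (c%:~R - d%:~R)));
    [rewrite uvR mulr1 | ring].
move: t01; rewrite tE ler0z lerz1 => t01.
have [] : u * (a - m) + v * (c - k) = 0 \/ u * (a - m) + v * (c - k) = 1 by lia.
  by move=> ->; left.
by move=> ->; right.
Qed.

Theorem theorem2p2 (R : realType) (V : finType) (e : rel V) :
  simple_graph e -> colorable e 4 ->
  exists f : V -> 'rV[R]_2, sequential_embedding e f.
Proof.
move=> _ [c cP].
have [x [y [xinj xyP]]] :=
  colored_placement (fun i : 'I_#|V| => c (enum_val i)).
pose g v : 'I_2 -> nat :=
  fun k => if k == 0 then x (enum_rank v) else y (enum_rank v).
exists (fun v => \row_k (g v k)%:R); split.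
- move=> v w /rowP/(_ 0); rewrite !mxE /= => /eqP.
  by rewrite eqr_nat => /eqP/xinj/enum_rank_inj.
- by move=> v k; rewrite mxE pmulrn Num.Theory.intr_int.
move=> v w evw p [t [t01 ->]] pint.
have := pint 0; have := pint 1; rewrite !mxE /= !pmulrn => p1 p0.
have [] := coprime_segment_int _ t01 p0 p1.
- apply: coprimez_sub_nat; apply: xyP => /=; rewrite !enum_rankK; exact: cP.
- by move=> ->; left; rewrite subr0 scale1r scale0r addr0.
by move=> ->; right; rewrite subrr scale0r scale1r add0r.
Qed.
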